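(* Let $q$ be a solution of the sine-Gordon equation $q_{xt}=\sin q$, let $s\ne0$ be real and $0<c_0<\pi$. Set $$u=\begin{pmatrix}0&\frac{q_x}2\\-\frac{q_x}2&0\end{pmatrix},\qquad f_0=\tfrac12(q(0,0)+c_0),$$ and let $\pi$ be the Hermitian projection of $\mathbb C^2$ onto the complex line spanned by $(\cos\frac{f_0}2,\sin\frac{f_0}2)^t$, i.e. $$\pi=\begin{pmatrix}\cos^2\frac{f_0}2&\sin\frac{f_0}2\cos\frac{f_0}2\\ \sin\frac{f_0}2\cos\frac{f_0}2&\sin^2\frac{f_0}2\end{pmatrix}.$$ Then $B_{s,c_0}(q)=g_{is,\pi}*u$; that is, with $q^*=B_{s,c_0}(q)$, $$g_{is,\pi}*u=\begin{pmatrix}0&\frac{q^*_x}2\\-\frac{q^*_x}2&0\end{pmatrix}.$$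
   Context: Solutions $q:\mathbb R^2\to\mathbb R$ are smooth, with $q(x,t)\to0$ as $x\to-\infty$ and $q_x(\cdot,t)$ in the Schwartz class for each $t$, and a solution $q$ is identified with the matrix function $u$ of the claim. Classical Bäcklund transformation: for a solution $q$ of the sine-Gordon equation, real $s\ne0$ and $c_0\in\mathbb R$, $B_{s,c_0}(q)=q^*$ is the unique solution of $(q^*-q)_x=4s\sin\frac{q^*+q}2$, $(q^*+q)_t=\frac1s\sin\frac{q^*-q}2$ with $q^*(0,0)=c_0$. Let $a=\mathrm{diag}(i,-i)$, $b=-a/4$. The matrix $u$ is a solution of the $-1$-flow $u_t=[a,g^{-1}bg]$, where $g^{-1}g_x=u$, $\lim_{x\to-\infty}g(x,t)=I$. Its trivialization is the solution $E(x,t,\lambda)$, $\lambda\in\mathbb C\setminus\{0\}$, of $E_x=E(a\lambda+u)$, $E_t=E\lambda^{-1}g^{-1}bg$, $E(0,0,\lambda)=I$. For $z\in\mathbb C\setminus\mathbb R$ and a Hermitian projection $\pi$, $g_{z,\pi}(\lambda)=\pi+\frac{\lambda-z}{\lambda-\bar z}(I-\pi)$, and $g_{z,\pi}*u=u+(z-\bar z)[\tilde\pi,a]$, with $\tilde\pi(x,t)$ the Hermitian projection onto $E(x,t,z)^*(\pi(\mathbb C^2))$. *)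

(* Defs.v *)
From HB Require Import structures.
From mathcomp Require Import all_boot all_order all_algebra.
From mathcomp Require Import complex.
From mathcomp Require Import all_classical all_reals all_analysis.

Set Implicit Arguments.
Unset Strict Implicit.
Unset Printing Implicit Defensive.

Import Order.TTheory GRing.Theory Num.Theory.
Import numFieldNormedType.Exports.

Local Open Scope classical_set_scope.
Local Open Scope ring_scope.
Local Open Scope complex_scope.

Definition dx (R : realType) (q : R -> R -> R) (x t : R) : R :=
  derive1 (fun y => q y t) x.

Definition dt (R : realType) (q : R -> R -> R) (x t : R) : R :=
  derive1 (fun y => q x y) t.

(* [derive1] is a total operator, so differentiability is always stated
   separately. *)
Definition partially_derivable (R : realType) (q : R -> R -> R) : Prop :=
  forall x t, derivable (fun y => q y t) x 1 /\ derivable (fun y => q x y) t 1.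

(* The iterated partial derivative of q along a word in d/dx (true) and
   d/dt (false). *)
Definition partial_word (R : realType) (w : seq bool) (q : R -> R -> R) :=
  foldr (fun b : bool => if b then @dx R else @dt R) q w.

(* C^infinity on R^2: all iterated partial derivatives exist and are jointly
   continuous. *)
Definition smooth2 (R : realType) (q : R -> R -> R) : Prop :=
  forall w : seq bool,
    partially_derivable (partial_word w q) /\
    continuous (fun p : R * R => partial_word w q p.1 p.2).

Definition schwartz (R : realType) (f : R -> R) : Prop :=
  (forall (n : nat) (x : R), derivable (derive1n n f) x 1) /\
  (forall m n : nat, exists M : R, forall x : R, `|x ^+ m * derive1n n f x| <= M).

Definition sine_gordon_solution (R : realType) (q : R -> R -> R) : Prop :=
  [/\ smooth2 q,
      forall t, q x t @[x --> -oo] --> (0 : R),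
      forall t, schwartz (fun x => dx q x t) &
      forall x t, dt (dx q) x t = sin (q x t)].

(* The defining system of q^* = B_{s,c0}(q).  No decay is asked of q^*: as
   x -> -oo it may tend to a nonzero multiple of 2 pi. *)
Definition is_backlund (R : realType) (s c0 : R) (q qs : R -> R -> R) : Prop :=
  [/\ partially_derivable qs,
      forall x t, dx (fun x t => qs x t - q x t) x t
                  = 4 * s * sin ((qs x t + q x t) / 2),
      forall x t, dt (fun x t => qs x t + q x t) x t
                  = s^-1 * sin ((qs x t - q x t) / 2) &
      qs 0 0 = c0].

Definition mx2 (T : Type) (a b c d : T) : 'M[T]_2 :=
  \matrix_(i < 2, j < 2)
    if i == 0 then (if j == 0 then a else b) else (if j == 0 then c else d).

Definition col2 (T : Type) (a b : T) : 'cV[T]_2 :=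
  \col_(i < 2) if i == 0 then a else b.

Definition adj (R : realType) (m n : nat) (M : 'M[R[i]]_(m, n))
  : 'M[R[i]]_(n, m) := (map_mx conjc M)^T.

(* Limits and derivatives of matrix functions of a real variable are taken
   entrywise, on real and imaginary parts. *)
Definition mx_derivable (R : realType) (F : R -> 'M[R[i]]_2) (x : R) : Prop :=
  forall i j, derivable (fun y => complex.Re (F y i j)) x 1 /\
              derivable (fun y => complex.Im (F y i j)) x 1.

Definition mx_derive (R : realType) (F : R -> 'M[R[i]]_2) (x : R)
  : 'M[R[i]]_2 :=
  \matrix_(i < 2, j < 2) (derive1 (fun y => complex.Re (F y i j)) x
                      +i* derive1 (fun y => complex.Im (F y i j)) x).

Definition mx_cvg (R : realType) (F : R -> 'M[R[i]]_2) (l : set_system R)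
    (M : 'M[R[i]]_2) : Prop :=
  forall i j, complex.Re (F x i j) @[x --> l] --> complex.Re (M i j) /\
              complex.Im (F x i j) @[x --> l] --> complex.Im (M i j).

Definition amx (R : realType) : 'M[R[i]]_2 := mx2 (0 +i* 1) 0 0 (- (0 +i* 1)).
Definition bmx (R : realType) : 'M[R[i]]_2 := - (4^-1 *: amx R).

(* The matrix function u identified with q. *)
Definition sg_mx (R : realType) (q : R -> R -> R) (x t : R) : 'M[R[i]]_2 :=
  mx2 0 (dx q x t / 2)%:C (- (dx q x t / 2)%:C) 0.

Definition is_frame (R : realType) (u g : R -> R -> 'M[R[i]]_2) : Prop :=
  [/\ forall x t, g x t \in unitmx,
      forall x t, mx_derivable (fun y => g y t) x,
      forall x t, invmx (g x t) *m mx_derive (fun y => g y t) x = u x t &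
      forall t, mx_cvg (fun x => g x t) -oo%R 1%:M].

Definition is_trivialization (R : realType) (u g : R -> R -> 'M[R[i]]_2)
    (E : R -> R -> R[i] -> 'M[R[i]]_2) : Prop :=
  forall la : R[i], la != 0 ->
  [/\ forall x t, mx_derivable (fun y => E y t la) x /\
                  mx_derivable (fun y => E x y la) t,
      forall x t, mx_derive (fun y => E y t la) x
                  = E x t la *m (la *: amx R + u x t),
      forall x t, mx_derive (fun y => E x y la) t
        = E x t la *m (la^-1 *: (invmx (g x t) *m bmx R *m g x t)) &
      E 0 0 la = 1%:M].

Definition mx_range (R : realType) (M : 'M[R[i]]_2) : set 'cV[R[i]]_2 :=
  range (fun v : 'cV[R[i]]_2 => M *m v).

Definition is_herm_proj (R : realType) (V : set 'cV[R[i]]_2)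
    (P : 'M[R[i]]_2) : Prop :=
  [/\ adj P = P, P *m P = P & mx_range P = V].

(* The Hermitian projection onto V; the default 0 is only used when V is not a
   linear subspace. *)
Definition herm_proj (R : realType) (V : set 'cV[R[i]]_2) : 'M[R[i]]_2 :=
  xget 0 (is_herm_proj V).

Definition line (R : realType) (v : 'cV[R[i]]_2) : set 'cV[R[i]]_2 :=
  range (fun k : R[i] => k *: v).

(* The projection tilde pi(x,t), onto E(x,t,z)^* (pi(C^2)). *)
Definition dressed_proj (R : realType) (z : R[i]) (P : 'M[R[i]]_2)
    (E : R -> R -> R[i] -> 'M[R[i]]_2) (x t : R) : 'M[R[i]]_2 :=
  herm_proj ((fun v : 'cV[R[i]]_2 => adj (E x t z) *m v) @` mx_range P).

(* The action g_{z,pi} * u, where E is the trivialization of u. *)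
Definition dress (R : realType) (z : R[i]) (P : 'M[R[i]]_2)
    (E : R -> R -> R[i] -> 'M[R[i]]_2) (u : R -> R -> 'M[R[i]]_2) (x t : R)
  : 'M[R[i]]_2 :=
  u x t + (z - conjc z) *: (dressed_proj z P E x t *m amx R
                            - amx R *m dressed_proj z P E x t).

(* Main.v *)
Require Import Defs.
From HB Require Import structures.
From mathcomp Require Import all_boot all_order all_algebra.
From mathcomp Require Import complex.
From mathcomp Require Import all_classical all_reals all_analysis.
From mathcomp Require Import ring lra.
Import Order.TTheory GRing.Theory Num.Theory.
Import numFieldNormedType.Exports.
Local Open Scope classical_set_scope.
Local Open Scope ring_scope.
Local Open Scope complex_scope.

(** Write u for the matrix of q, th = (q + q* )/4, and e(th) = (cos th, sin th)^t.
At the spectral value z = is, the two equations of the trivialization E become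
linear systems with real coefficients for the columns
y = E(x,t,z)^* e(th(0,0)), because the frame g is forced to be the rotation by
q/2, so that z^-1 g^-1 b g is a real multiple of a reflection matrix
([frame_rot], [lax_x_real], [lax_t_real]).  For a planar linear system
y' = A y, the direction angle of a solution satisfies the scalar equation
th' = <n, A e>, where e = e(th) and n is e turned by a right angle.  For the two
systems at hand these scalar equations are
  th_x = q_x/2 + s sin(2 th),   th_t = sin(2 th - q) / (4 s),
which are exactly the two Baecklund equations for q* rewritten in th
([is_derive_angle_x], [is_derive_angle_t]).

Conversely, if th solves the scalar equation and y is parallel to e(th) at one
point, it remains so: the component h = <n, y> satisfies h' = <n, A n> h, and a
quantity whose derivative is bounded by a multiple of itself vanishes
identically once it vanishes somewhere ([gronwall_eq0], [planar_direction]).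
The same argument applied to |y|^2 shows that y never vanishes ([planar_eq0]).
Going from (0,0) to (x,0) and then to (x,t), y(x,t) spans the line of
e(th(x,t)), hence the dressed projection is the projection onto that line
([dressed_projE]).  Its off-diagonal entry sin(2 th)/2 turns the commutator
2is [pi, a] into the increment 2 s sin(2 th) = (q*_x - q_x)/2 of the potential. *)

(** * Scalar differential inequalities and planar linear systems *)

Section BacklundDressing.
Variable R : realType.
Implicit Types (f df F dF : R -> R) (a x k : R).

Lemma increment_derive f df x y : (forall x, is_derive x 1 f (df x)) ->
  x <= y -> exists c, f y - f x = df c * (y - x).
Proof.
move=> dfE xy.
have [|c _ ->] := MVT_segment xy (fun z _ => dfE z); last by exists c.
apply: continuous_subspaceT => z.
by apply: differentiable_continuous; apply/derivable1_diffP; apply: ex_derive.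
Qed.

Lemma derive0_cst f : (forall x, is_derive x 1 f 0) -> forall x y, f x = f y.
Proof.
move=> df0 x y; wlog xy : x y / x <= y.
  by move=> H; have [/H//|/ltW/H->] := leP x y.
have [c /eqP] := increment_derive f (fun=> 0) x y df0 xy.
by rewrite mul0r subr_eq0 => /eqP.
Qed.

Lemma is_derive_mul_exp F dF k x : is_derive x 1 F (dF x) ->
  is_derive x 1 (fun y => F y * expR (k * y)) ((dF x + k * F x) * expR (k * x)).
Proof.
move=> dFx; have dk : is_derive x 1 (fun y : R => k * y) k.
  by apply: (is_derive_eq (is_deriveZ k (is_derive_id x 1))); rewrite /GRing.scale /= mulr1.
have de := is_derive1_comp (is_derive_expR (k * x)) dk.
apply: (is_derive_eq (is_deriveM dFx de)).
rewrite /GRing.scale /=; ring.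
Qed.

(** Both F exp(-kx) and -F exp(kx) are nonincreasing, so a zero of F propagates
to its right by the former and to its left by the latter. *)
Lemma gronwall_eq0 F dF k a : (forall x, is_derive x 1 F (dF x)) ->
  (forall x, 0 <= F x) -> (forall x, `|dF x| <= k * F x) -> F a = 0 ->
  forall x, F x = 0.
Proof.
move=> dFE F0 dFk Fa x; apply/eqP; rewrite eq_le F0 andbT.
have [ax|/ltW xa] := leP a x.
- have [c /eqP] := increment_derive _ _ a x (fun z => is_derive_mul_exp F dF (- k) z (dFE z)) ax.
  rewrite Fa mul0r subr0 => /eqP FE.
  rewrite -(pmulr_lle0 _ (expR_gt0 (- k * x))) FE -mulrA.
  apply: mulr_le0_ge0; last by rewrite mulr_ge0 ?expR_ge0 ?subr_ge0.
  by have := dFk c; rewrite ler_norml => /andP[]; lra.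
- have [c /eqP] := increment_derive _ _ x a (fun z => is_derive_mul_exp F dF k z (dFE z)) xa.
  rewrite Fa mul0r sub0r eqr_oppLR => /eqP FE.
  rewrite -(pmulr_lle0 _ (expR_gt0 (k * x))) FE oppr_le0 -mulrA.
  apply: mulr_ge0; last by rewrite mulr_ge0 ?expR_ge0 ?subr_ge0.
  by have := dFk c; rewrite ler_norml => /andP[]; lra.
Qed.

Section PlanarSystem.
Variables (a b c d y1 y2 : R -> R) (k x0 : R).
Hypothesis dy1 : forall x, is_derive x 1 y1 (a x * y1 x + b x * y2 x).
Hypothesis dy2 : forall x, is_derive x 1 y2 (c x * y1 x + d x * y2 x).
Hypothesis quad_le : forall x v1 v2 : R,
  `|a x * v1 ^+ 2 + (b x + c x) * (v1 * v2) + d x * v2 ^+ 2|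
  <= k * (v1 ^+ 2 + v2 ^+ 2).

(** Gronwall for |y|^2, whose derivative is twice the quadratic form at y. *)
Lemma planar_eq0 : y1 x0 = 0 -> y2 x0 = 0 -> forall x, y1 x = 0 /\ y2 x = 0.
Proof.
move=> y10 y20 x.
have dN z := is_deriveD (is_deriveM (dy1 z) (dy1 z)) (is_deriveM (dy2 z) (dy2 z)).
have N0 := gronwall_eq0 _ _ (2 * k) x0 dN.
have : y1 x * y1 x + y2 x * y2 x = 0.
  apply: N0 => [z|z|].
  - by rewrite addr_ge0 // -expr2 sqr_ge0.
  - rewrite /GRing.scale /=.
    set X := (X in `|X| <= _).
    have -> : X = 2 * (a z * y1 z ^+ 2 + (b z + c z) * (y1 z * y2 z) + d z * y2 z ^+ 2).
      by rewrite /X; ring.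
    by rewrite normrM ger0_norm // -mulrA ler_wpM2l // -!expr2.
  - by change (y1 x0 * y1 x0 + y2 x0 * y2 x0 = 0); rewrite y10 y20 !mul0r addr0.
move/eqP; rewrite -!expr2 paddr_eq0 ?sqr_ge0// !sqrf_eq0.
by move=> /andP[/eqP -> /eqP ->].
Qed.

(** With e = (cos th, sin th) and n = (- sin th, cos th), the hypothesis on th
reads th' = <n, A e>.  It cancels the contribution of <e, y> to the derivative
of h = <n, y>, leaving h' = <n, A n> h, to which Gronwall applies. *)
Lemma planar_direction (th : R -> R) :
  (forall x, is_derive x 1 th
     (cos (th x) * (c x * cos (th x) + d x * sin (th x))
      - sin (th x) * (a x * cos (th x) + b x * sin (th x)))) ->
  cos (th x0) * y2 x0 = sin (th x0) * y1 x0 ->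
  forall x, cos (th x) * y2 x = sin (th x) * y1 x.
Proof.
move=> dth h0 x.
pose h z := cos (th z) * y2 z - sin (th z) * y1 z.
pose al z := a z * sin (th z) ^+ 2 + (b z + c z) * (- sin (th z) * cos (th z))
             + d z * cos (th z) ^+ 2.
have dh (z : R) : is_derive z 1 h (al z * h z).
  have dC := is_derive1_comp (is_derive_cos (th z)) (dth z).
  have dS := is_derive1_comp (is_derive_sin (th z)) (dth z).
  apply: (is_derive_eq (is_deriveB (is_deriveM dC (dy2 z)) (is_deriveM dS (dy1 z)))).
  rewrite /GRing.scale /= /al.
  have := cos2Dsin2 (th z).
  set C := cos (th z); set S := sin (th z) => CS.
  (* Express y in the orthonormal basis (e, n): y = r e + h n. *)
  pose r := C * y1 z + S * y2 z.
  have y1E : y1 z = C * r - S * h z.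
    rewrite /r /h -/C -/S -[LHS]mul1r -CS; ring.
  have y2E : y2 z = S * r + C * h z.
    rewrite /r /h -/C -/S -[LHS]mul1r -CS; ring.
  apply/eqP; rewrite -subr_eq0; apply/eqP.
  (* Modulo C^2 + S^2 = 1 both sides agree; their difference is this multiple. *)
  transitivity (r * (1 - (C ^+ 2 + S ^+ 2)) *
    (C * (c z * C + d z * S) - S * (a z * C + b z * S))).
    rewrite y1E y2E; ring.
  by rewrite CS subrr mulr0 mul0r.
have hh (z : R) : 0 <= h z * h z by rewrite -expr2 sqr_ge0.
have : h x * h x = 0.
  apply: (gronwall_eq0 _ _ (2 * k) x0 (fun z => is_deriveM (dh z) (dh z))) => // [z|].
  - set X := (X in `|X| <= _).
    have -> : X = 2 * al z * (h z * h z) by rewrite /X /GRing.scale /=; ring.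
    rewrite normrM (ger0_norm (hh z)).
    apply: ler_wpM2r => //; rewrite normrM ger0_norm// ler_wpM2l//.
    have := quad_le z (- sin (th z)) (cos (th z)).
    by rewrite sqrrN (addrC (sin (th z) ^+ 2)) cos2Dsin2 mulr1.
  - by change (h x0 * h x0 = 0); rewrite /h h0 subrr mul0r.
by move/eqP; rewrite mulf_eq0 orbb subr_eq0 => /eqP.
Qed.

End PlanarSystem.

(** * Two by two matrices *)

Lemma sum_ord2 (V : nmodType) (F : 'I_2 -> V) : \sum_(i < 2) F i = F 0 + F 1.
Proof.
by rewrite !big_ord_recl big_ord0 addr0; congr (_ + F _); apply: val_inj.
Qed.

Lemma ord2_ind (Q : 'I_2 -> Prop) : Q 0 -> Q 1 -> forall i, Q i.
Proof.
move=> Q0 Q1 [[|[|//]] H].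
- by rewrite (_ : Ordinal H = 0) //; apply: val_inj.
- by rewrite (_ : Ordinal H = 1) //; apply: val_inj.
Qed.

Lemma eq_mx2 (T : Type) (A B : 'M[T]_2) :
  A 0 0 = B 0 0 -> A 0 1 = B 0 1 -> A 1 0 = B 1 0 -> A 1 1 = B 1 1 -> A = B.
Proof. by move=> *; apply/matrixP; apply: ord2_ind; apply: ord2_ind. Qed.

Lemma eq_col2 (T : Type) (A B : 'cV[T]_2) :
  A 0 0 = B 0 0 -> A 1 0 = B 1 0 -> A = B.
Proof. by move=> *; apply/colP; apply: ord2_ind. Qed.

Lemma mx2E (T : Type) (a b c d : T) :
  (mx2 a b c d 0 0 = a) * (mx2 a b c d 0 1 = b)
  * (mx2 a b c d 1 0 = c) * (mx2 a b c d 1 1 = d).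
Proof. by rewrite !mxE. Qed.

Lemma col2E (T : Type) (a b : T) : (col2 a b 0 0 = a) * (col2 a b 1 0 = b).
Proof. by rewrite !mxE. Qed.

(** * Hermitian projections onto lines *)

Implicit Types (P Q : 'M[R[i]]_2) (V : set 'cV[R[i]]_2).

Lemma adj_mulmx P Q : adj (P *m Q) = adj Q *m adj P.
Proof. by rewrite /adj map_mxM trmx_mul. Qed.

Lemma mulmx_range_sub P Q : P *m P = P -> mx_range Q `<=` mx_range P ->
  P *m Q = Q.
Proof.
move=> PP QP; apply/matrixP => i j.
have [w _ Pw] : mx_range P (Q *m delta_mx j 0) by apply: QP; exists (delta_mx j 0).
have : P *m Q *m delta_mx j 0 = Q *m (delta_mx j 0 : 'cV_2).
  by rewrite -mulmxA -Pw mulmxA PP.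
by rewrite -!colE => /colP/(_ i); rewrite !mxE.
Qed.

(** Uniqueness: if P and Q are Hermitian idempotents with the same range, then
P Q = Q and Q P = P, and taking adjoints gives P = Q. *)
Lemma herm_proj_eq V P : is_herm_proj V P -> herm_proj V = P.
Proof.
move=> VP; apply: xget_unique => // Q [aQ QQ VQ]; case: VP => aP PP VP.
have PQ : P *m Q = Q by apply: mulmx_range_sub => //; rewrite VP VQ.
have QP : Q *m P = P by apply: mulmx_range_sub => //; rewrite VP VQ.
by rewrite -aQ -PQ adj_mulmx aP aQ QP.
Qed.

Definition dir (th : R) : 'cV[R[i]]_2 := col2 (cos th)%:C (sin th)%:C.

Definition proj_dir (th : R) : 'M[R[i]]_2 :=
  mx2 (cos th ^+ 2)%:C (sin th * cos th)%:C
      (sin th * cos th)%:C (sin th ^+ 2)%:C.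

Lemma proj_dir_mulmx th (v : 'cV[R[i]]_2) :
  proj_dir th *m v
  = ((cos th)%:C * v 0 0 + (sin th)%:C * v 1 0) *: dir th.
Proof.
by apply: eq_col2; rewrite !mxE sum_ord2 !mx2E /= !rmorphM /=; ring.
Qed.

Lemma is_herm_proj_dir th : is_herm_proj (line (dir th)) (proj_dir th).
Proof.
have fixD : proj_dir th *m dir th = dir th.
  rewrite proj_dir_mulmx /dir !col2E -!rmorphM -rmorphD /= -!expr2 cos2Dsin2.
  by rewrite scale1r.
split.
- by apply: eq_mx2; rewrite !mxE /= /conjc /real_complex_def oppr0.
- apply/matrixP => i j.
  have : proj_dir th *m proj_dir th *m delta_mx j 0
         = proj_dir th *m (delta_mx j 0 : 'cV_2).
    by rewrite -mulmxA (proj_dir_mulmx _ (delta_mx j 0)) -scalemxAr fixD.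
  by rewrite -!colE => /colP/(_ i); rewrite !mxE.
- rewrite eqEsubset; split=> _ [v _ <-].
  + by rewrite proj_dir_mulmx; exists ((cos th)%:C * v 0 0 + (sin th)%:C * v 1 0).
  + by exists (v *: dir th) => //; rewrite -scalemxAr fixD.
Qed.

Lemma herm_proj_dir th : herm_proj (line (dir th)) = proj_dir th.
Proof. exact: herm_proj_eq (is_herm_proj_dir th). Qed.

(** A nonzero vector E^* w satisfying the equation of the real line at angle th is
a nonzero complex multiple of its direction vector, so E^* maps the complex
line spanned by w onto the complex line at angle th. *)
Lemma dressed_proj_dir z (E : R -> R -> R[i] -> 'M[R[i]]_2) th0 th x t :
  (cos th)%:C * (adj (E x t z) *m dir th0) 1 0
  = (sin th)%:C * (adj (E x t z) *m dir th0) 0 0 ->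
  adj (E x t z) *m dir th0 != 0 ->
  dressed_proj z (proj_dir th0) E x t = proj_dir th.
Proof.
set y := adj _ *m _ => y_par y0.
pose r := (cos th)%:C * y 0 0 + (sin th)%:C * y 1 0.
have CS : (cos th)%:C * (cos th)%:C + (sin th)%:C * (sin th)%:C = 1 :> R[i].
  by rewrite -!rmorphM -rmorphD /= -!expr2 cos2Dsin2.
have yE : y = r *: dir th.
  apply: eq_col2; rewrite [RHS]mxE /dir col2E /r.
  - rewrite -[LHS]mul1r -CS mulrDl.
    by rewrite -[X in _ + X]mulrA -y_par; ring.
  - rewrite -[LHS]mul1r -CS mulrDl.
    by rewrite -[X in X + _]mulrA y_par; ring.
have r0 : r != 0.
  by apply: contraNneq y0 => r0; rewrite yE r0 scale0r.
rewrite /dressed_proj -(herm_proj_dir th); congr herm_proj.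
have [_ _ ->] := is_herm_proj_dir th0.
rewrite eqEsubset; split=> [_ [_ [k _ <-]] <-|_ [k _ <-]].
- by exists (k * r) => //; rewrite -scalemxAr -/y yE scalerA.
- exists ((k / r) *: dir th0); first by exists (k / r).
  by rewrite -scalemxAr -/y yE scalerA divfK.
Qed.

(** * Real and imaginary parts of linear matrix equations *)

(** Real part for true and imaginary part for false: a matrix equation with real
coefficients acts on both in the same way, so they are treated together. *)
Definition part (p : bool) (z : R[i]) : R :=
  if p then complex.Re z else complex.Im z.

Lemma partD p z w : part p (z + w) = part p z + part p w.
Proof. by case: p z w => -[z1 z2] [w1 w2]. Qed.

Lemma partZ p (r : R) z : part p (r%:C * z) = r * part p z.
Proof. by case: p z => -[z1 z2] /=; rewrite mul0r ?subr0 ?addr0. Qed.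

Lemma eq_parts (z w : R[i]) : (forall p, part p z = part p w) -> z = w.
Proof.
case: z w => [z1 z2] [w1 w2] zw.
by have /= -> := zw true; have /= -> := zw false.
Qed.

Lemma is_derive_part_mx (F : R -> 'M[R[i]]_2) (D : 'M[R[i]]_2) x p i j :
  mx_derivable F x -> mx_derive F x = D ->
  is_derive x 1 (fun y => part p (F y i j)) (part p (D i j)).
Proof.
move=> dF <-; have [dRe dIm] := dF i j.
by case: p; split=> //; rewrite mxE -derive1E.
Qed.

Lemma is_derive_part_linear (F : R -> 'M[R[i]]_2) (a b c d x : R) p i :
  mx_derivable F x -> mx_derive F x = F x *m mx2 a%:C b%:C c%:C d%:C ->
  is_derive x 1 (fun y => part p (F y i 0))
    (a * part p (F x i 0) + c * part p (F x i 1)) /\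
  is_derive x 1 (fun y => part p (F y i 1))
    (b * part p (F x i 0) + d * part p (F x i 1)).
Proof.
move=> dF FE; split; apply: is_derive_eq (is_derive_part_mx _ _ _ p _ _ dF FE) _;
by rewrite mxE sum_ord2 !mx2E partD ![F x i _ * _]mulrC !partZ.
Qed.

(** * The frame of a sine-Gordon potential *)

(** The row (r1, r2) turned back by the angle th is constant; since th tends to 0,
the constant is the limit of the row. *)
Lemma rotating_row (th v r1 r2 : R -> R) (l1 l2 : R) :
  (forall x : R, is_derive x 1 th (v x)) ->
  (forall x : R, is_derive x 1 r1 (- v x * r2 x)) ->
  (forall x : R, is_derive x 1 r2 (v x * r1 x)) ->
  th x @[x --> -oo] --> (0 : R) ->
  r1 x @[x --> -oo] --> l1 -> r2 x @[x --> -oo] --> l2 ->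
  forall x, r1 x = l1 * cos (th x) - l2 * sin (th x) /\
            r2 x = l1 * sin (th x) + l2 * cos (th x).
Proof.
move=> dth dr1 dr2 th0 rl1 rl2 x.
have dC (z : R) := is_derive1_comp (is_derive_cos (th z)) (dth z).
have dS (z : R) := is_derive1_comp (is_derive_sin (th z)) (dth z).
have C1 : cos (th x) @[x --> -oo] --> (1 : R).
  by rewrite -cos0; apply: continuous_cvg => //; apply: continuous_cos.
have S0 : sin (th x) @[x --> -oo] --> (0 : R).
  by rewrite -sin0; apply: continuous_cvg => //; apply: continuous_sin.
have cstE (f : R -> R) (l : R) : (forall z : R, is_derive z 1 f 0) ->
    f z @[z --> -oo] --> l -> f x = l.
  move=> /derive0_cst f0 fl.
  apply: (cvg_unique _ _ fl) => //.
  by rewrite (_ : f = cst (f x)); [exact: cvg_cst|apply/funext => z; exact: f0].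
have H1 : r1 x * cos (th x) + r2 x * sin (th x) = l1.
  apply: (cstE (fun x => r1 x * cos (th x) + r2 x * sin (th x))) => [z|].
  - apply: (is_derive_eq (is_deriveD (is_deriveM (dr1 z) (dC z)) (is_deriveM (dr2 z) (dS z)))).
    by rewrite /GRing.scale /=; ring.
  - rewrite (_ : l1 = l1 * 1 + l2 * 0); last by ring.
    by apply: cvgD; apply: cvgM.
have H2 : r2 x * cos (th x) - r1 x * sin (th x) = l2.
  apply: (cstE (fun x => r2 x * cos (th x) - r1 x * sin (th x))) => [z|].
  - apply: (is_derive_eq (is_deriveB (is_deriveM (dr2 z) (dC z)) (is_deriveM (dr1 z) (dS z)))).
    by rewrite /GRing.scale /=; ring.
  - rewrite (_ : l2 = l2 * 1 - l1 * 0); last by ring.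
    by apply: cvgB; apply: cvgM.
have CS := cos2Dsin2 (th x).
split.
- rewrite -H1 -H2 -[LHS]mul1r -CS; ring.
- rewrite -H1 -H2 -[LHS]mul1r -CS; ring.
Qed.

Definition rot (th : R) : 'M[R[i]]_2 :=
  mx2 (cos th)%:C (sin th)%:C (- sin th)%:C (cos th)%:C.

Lemma is_derive_dx (q : R -> R -> R) (x t : R) : partially_derivable q ->
  is_derive x 1 (fun y => q y t) (dx q x t).
Proof. by move=> /(_ x t)[qx _]; split=> //; rewrite /dx derive1E. Qed.

Lemma is_derive_dt (q : R -> R -> R) (x t : R) : partially_derivable q ->
  is_derive t 1 (fun y => q x y) (dt q x t).
Proof. by move=> /(_ x t)[_ qt]; split=> //; rewrite /dt derive1E. Qed.

Lemma is_derive_divr (f : R -> R) (df k x : R) : is_derive x 1 f df ->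
  is_derive x 1 (fun y => f y / k) (df / k).
Proof.
move=> dfx; rewrite (_ : (fun y => f y / k) = k^-1 \*: f).
  by apply: (is_derive_eq (is_deriveZ k^-1 dfx)); rewrite /GRing.scale /= mulrC.
by apply/funext => y; rewrite mulrC.
Qed.

Lemma sg_mxE (q : R -> R -> R) x t :
  sg_mx q x t = mx2 0%:C (dx q x t / 2)%:C (- (dx q x t / 2))%:C 0%:C.
Proof. by rewrite /sg_mx rmorphN. Qed.

(** The equation g_x = g u says that each row of g turns with angular speed
q_x/2, and the normalizations at -oo fix the constants of integration. *)
Lemma frame_rot (q : R -> R -> R) (g : R -> R -> 'M[R[i]]_2) x t :
  partially_derivable q -> (forall t, q x t @[x --> -oo] --> (0 : R)) ->
  is_frame (sg_mx q) g -> g x t = rot (q x t / 2).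
Proof.
move=> dq q0 [gU dg gu g1].
have gx z : mx_derive (fun y => g y t) z = g z t *m
    mx2 0%:C (dx q z t / 2)%:C (- (dx q z t / 2))%:C 0%:C.
  by rewrite -sg_mxE -gu mulKVmx.
have th0 : q x t / 2 @[x --> -oo] --> (0 : R).
  by rewrite -(mul0r 2^-1); apply: cvgM => //; apply: cvg_cst.
have rows p i : part p (g x t i 0) =
    part p ((1%:M : 'M[R[i]]_2) i 0) * cos (q x t / 2)
    - part p ((1%:M : 'M[R[i]]_2) i 1) * sin (q x t / 2) /\
    part p (g x t i 1) =
    part p ((1%:M : 'M[R[i]]_2) i 0) * sin (q x t / 2)
    + part p ((1%:M : 'M[R[i]]_2) i 1) * cos (q x t / 2).
  have lim j : part p (g x t i j) @[x --> -oo] --> part p ((1%:M : 'M[R[i]]_2) i j).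
    by case: p; have [] := g1 t i j.
  have dr z := is_derive_part_linear _ _ _ _ _ _ p i (dg z t) (gx z).
  apply: (rotating_row (fun x => q x t / 2) (fun x => dx q x t / 2)
     (fun x => part p (g x t i 0)) (fun x => part p (g x t i 1))) => // z.
  - exact/is_derive_divr/is_derive_dx.
  - by apply: is_derive_eq (dr z).1 _; rewrite mul0r add0r.
  - by apply: is_derive_eq (dr z).2 _; rewrite mul0r addr0.
apply: eq_mx2; rewrite mx2E; apply: eq_parts => p;
  rewrite ?(rows p _).1 ?(rows p _).2 !mxE /=;
  by case: p => /=; ring.
Qed.

(** Conjugating diag(1,-1) by the rotation of angle q/2 gives the reflection
matrix of angle q. *)
Lemma frame_conj_bmx (q : R -> R -> R) (g : R -> R -> 'M[R[i]]_2) x t :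
  partially_derivable q -> (forall t, q x t @[x --> -oo] --> (0 : R)) ->
  is_frame (sg_mx q) g ->
  invmx (g x t) *m bmx R *m g x t =
  - (0 +i* 4^-1) *: mx2 (cos (q x t))%:C (sin (q x t))%:C
                        (sin (q x t))%:C (- cos (q x t))%:C.
Proof.
move=> dq q0 gf; have gU : g x t \in unitmx by case: gf.
rewrite -mulmxA; apply: (canLR (mulKmx gU)).
rewrite (frame_rot q g x t dq q0 gf) -!scalemxAr.
set h := q x t / 2.
have -> : q x t = h + h by rewrite /h -splitr.
rewrite cosD sinD.
have := cos2Dsin2 h; rewrite /rot; set C := cos h; set S := sin h => CS.
have -> : bmx R = - (0 +i* 4^-1) *: mx2 1%:C 0%:C 0%:C (- 1)%:C.
  have e4 : (4^-1 : R[i]) = (4^-1 : R)%:C by rewrite fmorphV rmorph_nat.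
  rewrite /bmx /amx e4; apply: eq_mx2; rewrite !mxE /=;
    by apply/eqP; rewrite eq_complex; simpc => //=.
rewrite -scalemxAl; congr (_ *: _).
apply: eq_mx2; rewrite !mxE !sum_ord2 !mx2E
  -?rmorphN -?rmorphM -?rmorphD -?rmorphB -?rmorphM -?rmorphD -?rmorphB;
  congr (_%:C); apply/eqP; rewrite -subr_eq0; apply/eqP.
- transitivity ((1 - (C ^+ 2 + S ^+ 2)) * C); [ring|by rewrite CS subrr mul0r].
- transitivity ((1 - (C ^+ 2 + S ^+ 2)) * S); [ring|by rewrite CS subrr mul0r].
- transitivity ((1 - (C ^+ 2 + S ^+ 2)) * S); [ring|by rewrite CS subrr mul0r].
- transitivity ((C ^+ 2 + S ^+ 2 - 1) * C); [ring|by rewrite CS subrr mul0r].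
Qed.

(** * The Lax pair at an imaginary spectral value *)

Implicit Types (q qs : R -> R -> R) (s v : R).

Lemma lax_x_real s q x t :
  (0 +i* s) *: amx R + sg_mx q x t
  = mx2 (- s)%:C (dx q x t / 2)%:C (- (dx q x t / 2))%:C s%:C.
Proof.
rewrite sg_mxE; apply: eq_mx2; rewrite !mxE /=;
  by apply/eqP; rewrite eq_complex; simpc;
  rewrite /= ?eqxx ?mulr0 ?mulr1 ?add0r ?addr0 ?oppr0 ?opprK ?eqxx.
Qed.

Lemma lax_t_real s q g x t :
  s != 0 -> partially_derivable q ->
  (forall t, q x t @[x --> -oo] --> (0 : R)) -> is_frame (sg_mx q) g ->
  (0 +i* s)^-1 *: (invmx (g x t) *m bmx R *m g x t)
  = mx2 (- (cos (q x t) / (4 * s)))%:C (- (sin (q x t) / (4 * s)))%:C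
        (- (sin (q x t) / (4 * s)))%:C (cos (q x t) / (4 * s))%:C.
Proof.
move=> s0 dq q0 gf; rewrite (frame_conj_bmx q g x t dq q0 gf) scalerA.
have -> : (0 +i* s)^-1 * - (0 +i* 4^-1) = (- (4 * s)^-1)%:C :> R[i].
  have z0 : (0 +i* s) != 0 :> R[i] by rewrite eq_complex /= eqxx.
  apply: (canLR (mulKf z0)); apply/eqP; rewrite eq_complex; simpc => /=.
  by apply/eqP; field.
by apply: eq_mx2; rewrite !mxE -rmorphM /= ?mulNr ?mulrN ?opprK mulrC.
Qed.

(** The antisymmetric part of the coefficient matrix drops out of the quadratic
form: this is why the bound does not depend on q_x. *)
Lemma quad_le_x s v v1 v2 :
  `|- s * v1 ^+ 2 + (- v + v) * (v1 * v2) + s * v2 ^+ 2|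
  <= `|s| * (v1 ^+ 2 + v2 ^+ 2).
Proof.
rewrite addNr mul0r addr0.
rewrite (_ : - s * v1 ^+ 2 + s * v2 ^+ 2 = s * (v2 ^+ 2 - v1 ^+ 2)); last by ring.
rewrite normrM ler_wpM2l // ler_norml.
have := sqr_ge0 v1; have := sqr_ge0 v2; lra.
Qed.

(** Cauchy-Schwarz for (cos th, sin th) and (v2^2 - v1^2, -2 v1 v2), the latter of
norm v1^2 + v2^2. *)
Lemma quad_le_t s th v1 v2 :
  `|- (cos th / (4 * s)) * v1 ^+ 2
    + (- (sin th / (4 * s)) + - (sin th / (4 * s))) * (v1 * v2)
    + cos th / (4 * s) * v2 ^+ 2|
  <= `|4 * s|^-1 * (v1 ^+ 2 + v2 ^+ 2).
Proof.
have CS := cos2Dsin2 th.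
rewrite (_ : - (cos th / _) * _ + _ + _ =
  (4 * s)^-1 * (cos th * (v2 ^+ 2 - v1 ^+ 2) - sin th * (2 * (v1 * v2)))); last by ring.
rewrite normrM normfV ler_wpM2l ?invr_ge0 //.
have N0 : 0 <= v1 ^+ 2 + v2 ^+ 2 by rewrite addr_ge0 ?sqr_ge0.
rewrite -(ger0_norm N0) -ler_sqr ?nnegrE // ?normr_ge0 // !real_normK ?num_real //.
have -> : (v1 ^+ 2 + v2 ^+ 2) ^+ 2 = (cos th ^+ 2 + sin th ^+ 2) *
   ((v2 ^+ 2 - v1 ^+ 2) ^+ 2 + (2 * (v1 * v2)) ^+ 2) by rewrite CS; ring.
rewrite -subr_ge0.
rewrite (_ : _ - _ =
  (sin th * (v2 ^+ 2 - v1 ^+ 2) + cos th * (2 * (v1 * v2))) ^+ 2) ?sqr_ge0 //.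
ring.
Qed.

(** The real or imaginary part of entry j of dir(th)^T M; up to conjugation, of
entry j of M^* dir(th), see [part_adj_dir]. *)
Definition row_part (th : R) (p : bool) (M : 'M[R[i]]_2) (j : 'I_2) : R :=
  cos th * part p (M 0 j) + sin th * part p (M 1 j).

Lemma is_derive_row_part th p (F : R -> 'M[R[i]]_2) (a b c d x : R) :
  mx_derivable F x -> mx_derive F x = F x *m mx2 a%:C b%:C c%:C d%:C ->
  is_derive x 1 (fun y => row_part th p (F y) 0)
    (a * row_part th p (F x) 0 + c * row_part th p (F x) 1) /\
  is_derive x 1 (fun y => row_part th p (F y) 1)
    (b * row_part th p (F x) 0 + d * row_part th p (F x) 1).
Proof.
move=> dF FE; rewrite /row_part.
have [d00 d01] := is_derive_part_linear F _ _ _ _ x p 0 dF FE.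
have [d10 d11] := is_derive_part_linear F _ _ _ _ x p 1 dF FE.
split.
- apply: (is_derive_eq (is_deriveD (is_deriveZ (cos th) d00) (is_deriveZ (sin th) d10))).
  by rewrite /GRing.scale /=; ring.
- apply: (is_derive_eq (is_deriveD (is_deriveZ (cos th) d01) (is_deriveZ (sin th) d11))).
  by rewrite /GRing.scale /=; ring.
Qed.

Lemma part_adj_dir th p (M : 'M[R[i]]_2) j :
  part p ((adj M *m dir th) j 0) = (if p then 1 else -1) * row_part th p M j.
Proof.
rewrite mxE sum_ord2 /row_part /dir !mxE /=.
case: (M 0 j) (M 1 j) => [a b] [c d].
by case: p => /=; ring.
Qed.

(** * Transport of the direction *)

Section Transport.
Variables (q qs : R -> R -> R) (s c0 : R).
Variables (g : R -> R -> 'M[R[i]]_2) (E : R -> R -> R[i] -> 'M[R[i]]_2).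
Hypotheses (dq : partially_derivable q)
  (q0 : forall t, q x t @[x --> -oo] --> (0 : R)) (s0 : s != 0).
Hypotheses (gf : is_frame (sg_mx q) g) (Et : is_trivialization (sg_mx q) g E).
Hypothesis qsB : is_backlund s c0 q qs.

Let half_angle x t := (q x t + qs x t) / 2 / 2.
Let z : R[i] := 0 +i* s.

Let z0 : z != 0. Proof. by rewrite eq_complex /= eqxx. Qed.

Lemma backlund_dx x t : dx qs x t = dx q x t + 4 * s * sin ((qs x t + q x t) / 2).
Proof.
have [dqs /(_ x t) dqsq _ _] := qsB.
have d : is_derive x 1 (fun y => qs y t - q y t) (dx qs x t - dx q x t).
  exact: is_deriveB (is_derive_dx qs x t dqs) (is_derive_dx q x t dq).
by rewrite -dqsq [X in _ + X]/dx derive1E derive_val addrC subrK.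
Qed.

Lemma is_derive_angle_x (x t : R) :
  is_derive x 1 (fun y => half_angle y t)
    (dx q x t / 2 + s * sin (half_angle x t + half_angle x t)).
Proof.
have [dqs _ _ _] := qsB.
have d := is_deriveD (is_derive_dx q x t dq) (is_derive_dx qs x t dqs).
apply: (is_derive_eq (is_derive_divr _ _ 2 _ (is_derive_divr _ _ 2 _ d))).
by rewrite backlund_dx -splitr (addrC (q x t)); field.
Qed.

Lemma is_derive_angle_t (x t : R) :
  is_derive t 1 (half_angle x)
    ((4 * s)^-1 * sin (half_angle x t + half_angle x t - q x t)).
Proof.
have [dqs _ /(_ x t) qst _] := qsB.
have d := is_deriveD (is_derive_dt q x t dq) (is_derive_dt qs x t dqs).
apply: (is_derive_eq (is_derive_divr _ _ 2 _ (is_derive_divr _ _ 2 _ d))).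
have -> : dt q x t + dt qs x t = s^-1 * sin ((qs x t - q x t) / 2).
  have e : is_derive t 1 (fun y => qs x y + q x y) (dt qs x t + dt q x t).
    exact: is_deriveD (is_derive_dt qs x t dqs) (is_derive_dt q x t dq).
  by rewrite -qst [RHS]/dt derive1E derive_val addrC.
rewrite /half_angle -splitr (_ : _ / 2 - q x t = (qs x t - q x t) / 2); last by field.
by field.
Qed.

Let th0 := half_angle 0 0.

Lemma row_part_x p (t x : R) :
  is_derive x 1 (fun y => row_part th0 p (E y t z) 0)
   (- s * row_part th0 p (E x t z) 0 + - (dx q x t / 2) * row_part th0 p (E x t z) 1) /\
  is_derive x 1 (fun y => row_part th0 p (E y t z) 1)
   (dx q x t / 2 * row_part th0 p (E x t z) 0 + s * row_part th0 p (E x t z) 1).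
Proof.
have [dE Ex _ _] := Et z z0.
by apply: is_derive_row_part; [exact: (dE x t).1|rewrite Ex lax_x_real].
Qed.

Lemma row_part_t p (x t : R) :
  is_derive t 1 (fun y => row_part th0 p (E x y z) 0)
   (- (cos (q x t) / (4 * s)) * row_part th0 p (E x t z) 0
    + - (sin (q x t) / (4 * s)) * row_part th0 p (E x t z) 1) /\
  is_derive t 1 (fun y => row_part th0 p (E x y z) 1)
   (- (sin (q x t) / (4 * s)) * row_part th0 p (E x t z) 0
    + cos (q x t) / (4 * s) * row_part th0 p (E x t z) 1).
Proof.
have [dE _ Ext _] := Et z z0.
by apply: is_derive_row_part; [exact: (dE x t).2|rewrite Ext (lax_t_real s q)].
Qed.

Lemma row_part00 p : row_part th0 p (E 0 0 z) 0 = (if p then cos th0 else 0) /\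
  row_part th0 p (E 0 0 z) 1 = (if p then sin th0 else 0).
Proof.
have [_ _ _ ->] := Et z z0; rewrite /row_part !mxE /=.
by case: p => /=; rewrite !(mulr0, mulr1, addr0, add0r).
Qed.

(** The identity holds at (0,0); the x-equation carries it along t = 0, and the
t-equation carries it from (x,0) to (x,t). *)
Lemma row_part_direction p x t :
  cos (half_angle x t) * row_part th0 p (E x t z) 1
  = sin (half_angle x t) * row_part th0 p (E x t z) 0.
Proof.
have at_x0 y : cos (half_angle y 0) * row_part th0 p (E y 0 z) 1
             = sin (half_angle y 0) * row_part th0 p (E y 0 z) 0.
  apply: (planar_direction _ _ _ _ _ _ `|s| 0 (fun z => (row_part_x p 0 z).1)
    (fun z => (row_part_x p 0 z).2) (fun z => quad_le_x s _) (fun y => half_angle y 0)) => [w|].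
  - apply: is_derive_eq (is_derive_angle_x w 0) _.
    have := cos2Dsin2 (half_angle w 0); rewrite sinD => CS.
    by rewrite -[X in X + _]mul1r -CS; ring.
  - have [-> ->] := row_part00 p; case: p; rewrite ?mulr0 // -/th0; exact: mulrC.
apply: (planar_direction _ _ _ _ _ _ `|4 * s|^-1 0 (fun z => (row_part_t p x z).1)
    (fun z => (row_part_t p x z).2) (fun w => quad_le_t s (q x w)) (half_angle x)) => // w.
apply: is_derive_eq (is_derive_angle_t x w) _.
by rewrite sinB cosD sinD; ring.
Qed.

(** A zero at (x,t) would propagate back to (0,0), where the real part is the unit
vector e(th(0,0)). *)
Lemma row_part_neq0 x t :
  ~ (row_part th0 true (E x t z) 0 = 0 /\
     row_part th0 true (E x t z) 1 = 0).
Proof.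
move=> [Y0 Y1].
have [Y0x Y1x] := planar_eq0 _ _ _ _ _ _ `|4 * s|^-1 t (fun z => (row_part_t true x z).1)
    (fun z => (row_part_t true x z).2) (fun w => quad_le_t s (q x w)) Y0 Y1 0.
have := planar_eq0 _ _ _ _ _ _ `|s| x (fun z => (row_part_x true 0 z).1)
    (fun z => (row_part_x true 0 z).2) (fun z => quad_le_x s _) Y0x Y1x 0.
have [-> ->] := row_part00 true => -[C0 S0].
by have /eqP := cos2Dsin2 th0; rewrite C0 S0 !expr0n addr0 eq_sym oner_eq0.
Qed.

Lemma dressed_projE x t :
  dressed_proj z (proj_dir th0) E x t = proj_dir (half_angle x t).
Proof.
apply: dressed_proj_dir.
- apply: eq_parts => p; rewrite !partZ !part_adj_dir !mulrA.
  by rewrite ![_ * (if p then _ else _)]mulrC -!mulrA row_part_direction.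
- apply/eqP => y0; apply: (row_part_neq0 x t); split.
  + by rewrite -[LHS]mul1r -(part_adj_dir _ true) y0 mxE.
  + by rewrite -[LHS]mul1r -(part_adj_dir _ true) y0 mxE.
Qed.

Lemma dress_backlund x t : dress z (proj_dir th0) E (sg_mx q) x t = sg_mx qs x t.
Proof.
rewrite /dress dressed_projE !sg_mxE backlund_dx.
have -> : (qs x t + q x t) / 2 = half_angle x t + half_angle x t.
  by rewrite /half_angle -splitr addrC.
rewrite sinD /z /conjc.
apply: eq_mx2; rewrite !mxE !sum_ord2 !mxE /=;
  apply/eqP; rewrite eq_complex; simpc => //=;
  by rewrite andbT; apply/eqP; field.
Qed.

End Transport.

End BacklundDressing.

Theorem mainTheorem9 (R : realType) (q : R -> R -> R) (s c0 : R)
    (g : R -> R -> 'M[R[i]]_2) (E : R -> R -> R[i] -> 'M[R[i]]_2) :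
  sine_gordon_solution q -> s != 0 -> 0 < c0 -> c0 < pi ->
  is_frame (sg_mx q) g ->
  is_trivialization (sg_mx q) g E ->
  let f0 : R := (q 0 0 + c0) / 2 in
  let P : 'M[R[i]]_2 :=
    herm_proj (line (col2 (cos (f0 / 2))%:C (sin (f0 / 2))%:C)) in
  P = mx2 (cos (f0 / 2) ^+ 2)%:C (sin (f0 / 2) * cos (f0 / 2))%:C
          (sin (f0 / 2) * cos (f0 / 2))%:C (sin (f0 / 2) ^+ 2)%:C
  /\ forall qs : R -> R -> R, is_backlund s c0 q qs ->
     forall x t : R, dress (0 +i* s) P E (sg_mx q) x t = sg_mx qs x t.
Proof.
move=> [qsm qlim _ _] s0 _ _ gf Et f0 P.
have PE : P = proj_dir R (f0 / 2) by exact: herm_proj_dir.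
have dq : partially_derivable q by have [] := qsm [::].
split=> [//|qs qsB x t]; rewrite PE.
have <- : (q 0 0 + qs 0 0) / 2 / 2 = f0 / 2 by case: qsB => _ _ _ ->.
exact: (dress_backlund R q qs s c0 g E).
Qed.
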